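(* Let $\mathcal{B}=(b_{i_1\cdots i_m})$ be a symmetric quasi-double $B$-tensor of order $m$ and dimension $n$. Then at least one of the following holds: $\mathcal{B}$ is itself a Q-DSDD symmetric $Z$-tensor, or $$\mathcal{B}=\mathcal{M}+\sum_{k=1}^{s}h_k\,\varepsilon^{\hat{J}_k},$$ where $\mathcal{M}$ is a Q-DSDD symmetric $Z$-tensor, $s$ is a positive integer, and $h_k>0$ and $\hat{J}_k\subseteq N$ for $k=1,2,\ldots,s$. Furthermore, if $m$ is even, then $\mathcal{B}$ is positive definite, and consequently $\mathcal{B}$ is a $P$-tensor.
   Context: Let $m\ge 2$, $n\ge 2$, $N=\{1,\ldots,n\}$. A real tensor $\mathcal{A}=(a_{i_1\cdots i_m})$ of order $m$ and dimension $n$ consists of $n^m$ real entries indexed by $i_1,\ldots,i_m\in N$. It is symmetric if its entries are invariant under all permutations of the $m$ indices. $\delta_{i_1\cdots i_m}=1$ if $i_1=\cdots=i_m$ and $0$ otherwise; entries with $\delta_{i_1\cdots i_m}=0$ are called off-diagonal. For $i\in N$ put $\beta_i(\mathcal{A})=\max\{0,\ a_{ij_2\cdots j_m}: j_2,\ldots,j_m\in N,\ \delta_{ij_2\cdots j_m}=0\}$ and $\Delta_i(\mathcal{A})=\sum_{i_2,\ldots,i_m\in N,\ \delta_{ii_2\cdots i_m}=0}(\beta_i(\mathcal{A})-a_{ii_2\cdots i_m})$. For $i\ne j$ put $\Delta_j^i(\mathcal{A})=\Delta_j(\mathcal{A})-(\beta_j(\mathcal{A})-a_{ji\cdots i})$.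 A real tensor $\mathcal{B}=(b_{i_1\cdots i_m})$ is a quasi-double $B$-tensor if $b_{i\cdots i}>\beta_i(\mathcal{B})$ for all $i\in N$ and, for all $i,j\in N$ with $i\neq j$, $$(b_{i\cdots i}-\beta_i(\mathcal{B}))\,(b_{j\cdots j}-\beta_j(\mathcal{B})-\Delta_j^i(\mathcal{B}))>(\beta_j(\mathcal{B})-b_{ji\cdots i})\,\Delta_i(\mathcal{B}).$$ A $Z$-tensor is a real tensor all of whose off-diagonal entries are non-positive. Let $r_i(\mathcal{A})=\sum_{i_2,\ldots,i_m\in N,\ \delta_{ii_2\cdots i_m}=0}|a_{ii_2\cdots i_m}|$ and, for $i\ne j$, $r_j^i(\mathcal{A})=r_j(\mathcal{A})-|a_{ji\cdots i}|$. A tensor $\mathcal{A}$ of dimension $n\ge2$ is quasi-doubly strictly diagonally dominant (Q-DSDD) if $|a_{i\cdots i}|\,(|a_{j\cdots j}|-r_j^i(\mathcal{A}))>r_i(\mathcal{A})\,|a_{ji\cdots i}|$ for all $i,j\in N$ with $j\ne i$. For nonempty $J\subseteq N$, $\varepsilon^{J}$ denotes the partially all one tensor of order $m$ and dimension $n$: its $(i_1,\ldots,i_m)$ entry is $1$ if $i_1,\ldots,i_m\in J$, and $0$ otherwise. For $x\in\mathbb{R}^n$, $\mathcal{A}x^m=\sum_{i_1,\ldots,i_m\in N}a_{i_1\cdots i_m}x_{i_1}\cdots x_{i_m}$ and $(\mathcal{A}x^{m-1})_i=\sum_{i_2,\ldots,i_m\in N}a_{ii_2\cdots i_m}x_{i_2}\cdots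 x_{i_m}$. $\mathcal{A}$ is positive definite if $\mathcal{A}x^m>0$ for every nonzero $x\in\mathbb{R}^n$. $\mathcal{A}$ is a $P$-tensor if $\max_{i\in N}x_i(\mathcal{A}x^{m-1})_i>0$ for every nonzero $x\in\mathbb{R}^n$. *)

(* Defs.v *)
From HB Require Import structures.
From mathcomp Require Import all_boot all_order all_algebra all_fingroup.
From mathcomp Require Import constructive_ereal reals.

Set Implicit Arguments.
Unset Strict Implicit.
Unset Printing Implicit Defensive.

Import Order.TTheory GRing.Theory Num.Theory.
Local Open Scope ring_scope.

(* [R^o] is [R] as a module over itself, so that tensors form an [lmodType]. *)
Definition tensor (R : realType) (m n : nat) := {ffun m.-tuple 'I_n -> R^o}.

(* Row-wise notions single out the first index, hence are stated for tensors
   of order [m.+1]: [entry A i t] is a_{i t_1 ... t_m}. *)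
Definition entry (R : realType) (m n : nat) (A : tensor R m.+1 n)
  (i : 'I_n) (t : m.-tuple 'I_n) : R := A [tuple of i :: t].

(* a_{j i ... i}; the diagonal entry a_{i i ... i} is [repentry A i i]. *)
Definition repentry (R : realType) (m n : nat) (A : tensor R m.+1 n)
  (j i : 'I_n) : R := entry A j [tuple of nseq m i].

Definition offdiag (n : nat) (s : seq 'I_n) : bool := ~~ constant s.

Definition symmetric_tensor (R : realType) (m n : nat) (A : tensor R m n) :=
  forall (s : 'S_m) (t : m.-tuple 'I_n), A [tuple tnth t (s k) | k < m] = A t.

Definition beta (R : realType) (m n : nat) (A : tensor R m.+1 n)
  (i : 'I_n) : R :=
  \big[Num.max/0]_(t : m.-tuple 'I_n | offdiag (i :: t)) entry A i t.

Definition Delta (R : realType) (m n : nat) (A : tensor R m.+1 n)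
  (i : 'I_n) : R :=
  \sum_(t : m.-tuple 'I_n | offdiag (i :: t)) (beta A i - entry A i t).

(* [Delta_excl A j i] is Delta_j^i(A), used for i != j. *)
Definition Delta_excl (R : realType) (m n : nat) (A : tensor R m.+1 n)
  (j i : 'I_n) : R := Delta A j - (beta A j - repentry A j i).

Definition quasi_double_B (R : realType) (m n : nat) (B : tensor R m.+1 n) :=
  (forall i : 'I_n, repentry B i i > beta B i) /\
  (forall i j : 'I_n, i != j ->
     (repentry B i i - beta B i)
       * (repentry B j j - beta B j - Delta_excl B j i)
     > (beta B j - repentry B j i) * Delta B i).

Definition Z_tensor (R : realType) (m n : nat) (A : tensor R m n) :=
  forall t : m.-tuple 'I_n, offdiag t -> (A t : R) <= 0.

Definition offsum (R : realType) (m n : nat) (A : tensor R m.+1 n)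
  (i : 'I_n) : R :=
  \sum_(t : m.-tuple 'I_n | offdiag (i :: t)) `|entry A i t|.

(* [offsum_excl A j i] is r_j^i(A), used for i != j. *)
Definition offsum_excl (R : realType) (m n : nat) (A : tensor R m.+1 n)
  (j i : 'I_n) : R := offsum A j - `|repentry A j i|.

Definition QDSDD (R : realType) (m n : nat) (A : tensor R m.+1 n) :=
  forall i j : 'I_n, j != i ->
    `|repentry A i i| * (`|repentry A j j| - offsum_excl A j i)
    > offsum A i * `|repentry A j i|.

Definition partially_all_one (R : realType) (m n : nat) (J : {set 'I_n}) :
  tensor R m n :=
  [ffun t : m.-tuple 'I_n => (all (fun i => i \in J) t)%:R].

(* A x^m *)
Definition tform (R : realType) (m n : nat) (A : tensor R m n)
  (x : 'rV[R]_n) : R :=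
  \sum_(t : m.-tuple 'I_n) (A t : R) * \prod_(k < m) x 0 (tnth t k).

(* (A x^{m-1})_i, for A of order m *)
Definition tapply (R : realType) (m n : nat) (A : tensor R m.+1 n)
  (x : 'rV[R]_n) (i : 'I_n) : R :=
  \sum_(t : m.-tuple 'I_n) entry A i t * \prod_(k < m) x 0 (tnth t k).

Definition positive_definite (R : realType) (m n : nat) (A : tensor R m n) :=
  forall x : 'rV[R]_n, x != 0 -> 0 < tform A x.

(* The maximum is taken in the extended reals, with -oo for the empty
   family, so that no spurious real value enters it. *)
Definition P_tensor (R : realType) (m n : nat) (A : tensor R m.+1 n) :=
  forall x : 'rV[R]_n, x != 0 ->
    (0%:E < \big[maxe/-oo]_(i < n) (x 0 i * tapply A x i)%:E)%E.

(* Main.v *)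
(** Let [J] be the set of rows with a positive off-diagonal entry and [h] the least
    [beta] over [J]. By symmetry every positive off-diagonal entry has all its
    indices in [J], so subtracting [h] times the all-one tensor on [J] lowers each
    [beta_i], [i] in [J], by exactly [h]. This keeps [b_ii - beta_i], does not
    increase any gap [beta_i - b_it], hence preserves the quasi-double B condition,
    and removes at least one row from [J]; iterating ends at a quasi-double
    B-tensor with [beta = 0], which is a Q-DSDD Z-tensor with positive diagonal.

    For even order the all-one tensors contribute even powers
    [(sum_(i in J) x_i)^(m+1)]. A symmetric Q-DSDD tensor with positive diagonal
    becomes strictly diagonally dominant after a positive diagonal scaling, and
    AM-GM then shows that it is positive definite. *)

Require Import Defs.
From HB Require Import structures.
From mathcomp Require Import all_boot all_order all_algebra all_fingroup.
From mathcomp Require Import constructive_ereal reals.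
From mathcomp Require Import ring lra.

Set Implicit Arguments.
Unset Strict Implicit.
Unset Printing Implicit Defensive.

Import Order.TTheory GRing.Theory Num.Theory.
Local Open Scope ring_scope.

(** * Index tuples, off-diagonality and symmetry *)

Lemma sum_tuple_cons (V : nmodType) (T : finType) (m : nat)
    (F : m.+1.-tuple T -> V) :
  \sum_t F t = \sum_i \sum_(t : m.-tuple T) F [tuple of i :: t].
Proof.
rewrite pair_big /= (reindex (fun p : T * m.-tuple T => [tuple of p.1 :: p.2])) //.
exists (fun t => (thead t, [tuple of behead t])) => [[i t] _ | t _] /=.
  by congr pair; apply: val_inj.
by rewrite [t in RHS]tuple_eta.
Qed.

Lemma notoffdiag_cons (n m : nat) (i : 'I_n) (t : m.-tuple 'I_n) :
  ~~ offdiag (i :: t) = (t == [tuple of nseq m i]).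
Proof.
rewrite /offdiag negbK /=; apply/all_pred1P/eqP => [E | ->].
  by apply/val_inj; rewrite /= {1}E size_tuple.
by rewrite /= size_nseq.
Qed.

Lemma offdiag_cons_nseq (n m : nat) (i j : 'I_n) : (0 < m)%N -> j != i ->
  offdiag (j :: nseq m i).
Proof. by case: m => // m _ ji; rewrite /offdiag /= eq_sym (negPf ji). Qed.

Lemma perm_offdiag (n : nat) (s t : seq 'I_n) :
  perm_eq s t -> offdiag s = offdiag t.
Proof.
move=> st; congr (~~ _); case: s t st => [|i s] t st.
  by move/perm_size: st; case: t.
apply/(constantP i)/(constantP i) => -[j E]; exists j; apply/all_pred1P.
  by rewrite -(perm_all _ st) E; apply/all_pred1P; rewrite size_nseq.
by rewrite (perm_all _ st) E; apply/all_pred1P; rewrite size_nseq.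
Qed.

Lemma symmetric_tensorP (R : realType) (m n : nat) (A : tensor R m n) :
  symmetric_tensor A <-> forall s t : m.-tuple 'I_n, perm_eq s t -> A s = A t.
Proof.
split=> [symA s t /tuple_permP [p E] | permA p t].
  by rewrite -(symA p t); congr (A _); apply/val_inj.
by apply: permA; apply/tuple_permP; exists p.
Qed.

(** By symmetry any index of an entry can serve as its row index; this carries information from row
    [i] to row [j]. *)
Lemma symmetric_entry_pull (R : realType) (m n : nat) (A : tensor R m.+1 n)
    (i j : 'I_n) (t : m.-tuple 'I_n) :
  symmetric_tensor A -> j \in i :: t ->
  exists2 u : m.-tuple 'I_n, perm_eq (i :: t) (j :: u) & entry A i t = entry A j u.
Proof.
move=> /symmetric_tensorP permA jt.
have sz : size (rem j (i :: t)) == m by rewrite size_rem // size_tuple.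
by exists (Tuple sz) => [|]; [|apply: permA]; apply: perm_to_rem.
Qed.

(** * Homogeneous forms of tensors *)

Lemma prod_tuple_cons (R : realType) (m n : nat) (x : 'I_n -> R) (i : 'I_n)
    (t : m.-tuple 'I_n) :
  \prod_(k < m.+1) x (tnth [tuple of i :: t] k) = x i * \prod_(j <- t) x j.
Proof. by rewrite -(big_tuple 1 *%R [tuple of i :: t] xpredT x) big_cons. Qed.

Lemma tapplyE (R : realType) (m n : nat) (A : tensor R m.+1 n) (x : 'rV[R]_n) i :
  tapply A x i = \sum_(t : m.-tuple 'I_n) entry A i t * \prod_(j <- t) x 0 j.
Proof. by apply: eq_bigr => t _; rewrite big_tuple. Qed.

Lemma tform_rows (R : realType) (m n : nat) (A : tensor R m.+1 n) (x : 'rV[R]_n) :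
  tform A x = \sum_i x 0 i * tapply A x i.
Proof.
rewrite /tform sum_tuple_cons; apply: eq_bigr => i _.
rewrite tapplyE mulr_sumr; apply: eq_bigr => t _.
by rewrite (prod_tuple_cons (x 0)) mulrCA.
Qed.

(** The form is the sum of the [x 0 i * tapply A x i], and a positive sum has a positive term. *)
Lemma positive_definite_P_tensor (R : realType) (m n : nat) (A : tensor R m.+1 n) :
  positive_definite A -> P_tensor A.
Proof.
move=> pdA x /pdA; rewrite tform_rows => pos.
have [i posi] : exists i, 0 < x 0 i * tapply A x i.
  apply/existsP; apply: contraTT pos; rewrite negb_exists -leNgt => /forallP neg.
  by apply: sumr_le0 => i _; rewrite leNgt.
apply: (@lt_le_trans _ _ (x 0 i * tapply A x i)%:E); first by rewrite lte_fin.
exact: (le_bigmax _ (fun i => (x 0 i * tapply A x i)%:E)).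
Qed.

Lemma sum_all_prod (R : realType) (m n : nat) (J : {set 'I_n}) (x : 'I_n -> R) :
  \sum_(t : m.-tuple 'I_n) (all (fun i => i \in J) t)%:R * \prod_(j <- t) x j
    = (\sum_(i in J) x i) ^+ m.
Proof.
elim: m => [|m IH].
  rewrite (big_pred1 [tuple]) => [|t]; last exact/esym/eqP/tuple0.
  by rewrite big_nil mulr1.
rewrite sum_tuple_cons exprS -IH mulr_suml [RHS]big_mkcond /=; apply: eq_bigr => i _.
case: (i \in J) => /=; last by rewrite big1 // => t _; rewrite mul0r.
by rewrite mulr_sumr; apply: eq_bigr => t _; rewrite big_cons mulrCA.
Qed.

Lemma tform_partially_all_one (R : realType) (m n : nat) (J : {set 'I_n})
    (x : 'rV[R]_n) :
  tform (partially_all_one R m J) x = (\sum_(i in J) x 0 i) ^+ m.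
Proof.
rewrite -sum_all_prod; apply: eq_bigr => t _.
by rewrite ffunE (big_tuple _ _ t).
Qed.

Lemma tformD (R : realType) (m n : nat) (A B : tensor R m n) (x : 'rV[R]_n) :
  tform (A + B) x = tform A x + tform B x.
Proof. by rewrite -big_split; apply: eq_bigr => t _; rewrite ffunE mulrDl. Qed.

Lemma tformZ (R : realType) (m n : nat) (a : R) (A : tensor R m n) (x : 'rV[R]_n) :
  tform (a *: A) x = a * tform A x.
Proof. by rewrite /tform mulr_sumr; apply: eq_bigr => t _; rewrite ffunE mulrA. Qed.

Lemma tform_sum (R : realType) (m n : nat) (I : Type) (r : seq I)
    (A : I -> tensor R m n) (x : 'rV[R]_n) :
  tform (\sum_(i <- r) A i) x = \sum_(i <- r) tform (A i) x.
Proof.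
apply: (big_morph (fun T : tensor R m n => tform T x)) => [C D|]; first exact: tformD.
by rewrite /tform big1 // => t _; rewrite ffunE mul0r.
Qed.

(** * Positive definiteness from weighted diagonal dominance *)

Lemma prod_le_mean_pow (R : realType) (m : nat) (z : 'I_m.+1 -> R) :
  (forall k, 0 <= z k) ->
  \prod_k z k <= (\sum_k z k ^+ m.+1) / m.+1%:R.
Proof.
move=> z0.
have := leif_AGM (A := 'I_m.+1) (E := fun k => z k ^+ m.+1).
move=> /(_ (fun k _ => exprn_ge0 _ (z0 k))) [+ _].
rewrite card_ord prodrXl ler_pXn2r // nnegrE.
  exact: prodr_ge0.
by rewrite divr_ge0 ?ler0n // sumr_ge0 // => k _; rewrite exprn_ge0.
Qed.

(** Swapping positions [0] and [k] is an involution on tuples that preserves [F], so every position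
    contributes equally. *)
Lemma sum_tuple_tnth (R : realType) (T : finType) (m : nat)
    (F : m.+1.-tuple T -> R) (z : T -> R) (k : 'I_m.+1) :
  (forall s t : m.+1.-tuple T, perm_eq s t -> F s = F t) ->
  \sum_t F t * z (tnth t k) = \sum_t F t * z (thead t).
Proof.
move=> permF.
pose g (t : m.+1.-tuple T) := [tuple tnth t (tperm ord0 k i) | i < m.+1].
have gK : involutive g.
  by move=> t; apply: eq_from_tnth => i; rewrite !tnth_mktuple tpermK.
rewrite (reindex_inj (inv_inj gK)); apply: eq_bigr => t _.
rewrite tnth_mktuple tpermR; congr (_ * z _).
by apply: permF; apply/tuple_permP; exists (tperm ord0 k).
Qed.

(* AM-GM applied to the ratios [|x_k| / y_k] reduces the form to a sum of row
   contributions, weighted by [(|x_i| / y_i)^{m+1} y_i]. *)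
Lemma positive_definite_of_weights (R : realType) (m n : nat)
    (A : tensor R m.+1 n) (y : 'I_n -> R) :
  ~~ odd m.+1 -> symmetric_tensor A -> (forall i, 0 < y i) ->
  (forall i, \sum_(t : m.-tuple 'I_n | offdiag (i :: t))
               `|entry A i t| * \prod_(j <- t) y j
             < repentry A i i * y i ^+ m) ->
  positive_definite A.
Proof.
move=> even /symmetric_tensorP permA y0 dom x x0.
pose z i := `|x 0 i| / y i.
have z0 i : 0 <= z i by rewrite divr_ge0 // ltW.
(* Off-diagonal entries become minus their moduli and every index is scaled by [y]; [dom] then makes
   all row sums of [C] positive. *)
pose C (s : m.+1.-tuple 'I_n) : R :=
  (if offdiag s then - `|A s| else A s) * \prod_(j <- s) y j.
have permC (s t : m.+1.-tuple _) : perm_eq s t -> C s = C t.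
  by move=> st; rewrite /C (perm_offdiag st) (permA _ _ st) (perm_big _ st).
have rowC i : \sum_(t : m.-tuple 'I_n) C [tuple of i :: t] =
  y i * (repentry A i i * y i ^+ m - \sum_(t : m.-tuple 'I_n | offdiag (i :: t))
               `|entry A i t| * \prod_(j <- t) y j).
  rewrite (bigID (fun t : m.-tuple 'I_n => offdiag (i :: t))) /= addrC.
  rewrite mulrBr mulr_sumr -sumrN; congr (_ + _).
    rewrite (eq_bigl (pred1 [tuple of nseq m i])) => [|t]; last exact: notoffdiag_cons.
    rewrite big_pred1_eq /C ifN ?notoffdiag_cons // big_cons.
    by rewrite big_nseq -Monoid.iteropE mulrCA.
  apply: eq_bigr => t ot; rewrite /C ot big_cons; rewrite /entry; ring.
(* Off the diagonal this is AM-GM with a negative coefficient. On the diagonal the mean is exact,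
   and the even exponent removes the absolute value. *)
have low s : C s * ((\sum_k z (tnth s k) ^+ m.+1) / m.+1%:R)
    <= (A s : R) * \prod_(k < m.+1) x 0 (tnth s k).
  have absx : \prod_(k < m.+1) `|x 0 (tnth s k)| =
      \prod_(j <- s) y j * \prod_k z (tnth s k).
    rewrite (big_tuple _ _ s) -big_split; apply: eq_bigr => k _ /=.
    by rewrite mulrCA divff ?mulr1 // gt_eqF.
  have y0s : 0 <= \prod_(j <- s) y j by apply: prodr_ge0 => j _; apply: ltW.
  rewrite /C; case: ifPn => os.
    rewrite !mulNr lerNl -mulrN; apply: le_trans (ler_norm _) _.
    rewrite normrM normrN normr_prod absx -mulrA ler_wpM2l // ler_wpM2l //.
    exact: prod_le_mean_pow.
  have [i Es] : exists i, s = [tuple of nseq m.+1 i].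
    case/tupleP: s os {absx y0s} => i t; rewrite notoffdiag_cons => /eqP ->.
    by exists i; apply/val_inj.
  have cst (f : 'I_n -> R) k : f (tnth s k) = f i.
    by rewrite Es tnth_nseq.
  have := absx; rewrite !(eq_bigr _ (fun k _ => cst (fun j => `|x 0 j|) k)).
  rewrite (eq_bigr _ (fun k _ => cst (fun j => z j ^+ m.+1) k)).
  rewrite (eq_bigr _ (fun k _ => cst z k)) (eq_bigr _ (fun k _ => cst (x 0) k)).
  rewrite !prodr_const sumr_const !card_ord -(mulr_natr (_ ^+ _)) mulfK ?pnatr_eq0 //.
  by rewrite -normrX ger0_norm ?exprn_even_ge0 // => ->; rewrite mulrA.
have low_sum : \sum_s C s * ((\sum_k z (tnth s k) ^+ m.+1) / m.+1%:R) <= tform A x.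
  by apply: ler_sum => s _; apply: low.
apply: lt_le_trans low_sum.
(* All [m.+1] positions give the same sum, which cancels the denominator and leaves row sums of [C]
   weighted by [z j ^+ m.+1]. *)
under eq_bigr => s _ do rewrite mulrA mulr_sumr.
rewrite -mulr_suml exchange_big /=.
under eq_bigr => k _ do
  rewrite (sum_tuple_tnth (fun i => z i ^+ m.+1) k permC).
rewrite sumr_const card_ord -(mulr_natr (\sum_t _)) mulfK ?pnatr_eq0 // sum_tuple_cons.
have [i xi] : exists i, x 0 i != 0.
  by apply/existsP; apply: contraNT x0; rewrite negb_exists => /forallP xz;
     apply/eqP/rowP => i; move/(_ i): xz; rewrite negbK mxE => /eqP.
have rowpos j : 0 < \sum_(t : m.-tuple 'I_n) C [tuple of j :: t].
  by rewrite rowC mulr_gt0 // subr_gt0.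
have rowE j : \sum_(t : m.-tuple 'I_n)
      C [tuple of j :: t] * z (thead [tuple of j :: t]) ^+ m.+1 =
   (\sum_(t : m.-tuple 'I_n) C [tuple of j :: t]) * z j ^+ m.+1.
  by rewrite mulr_suml.
under eq_bigr => j _ do rewrite rowE.
rewrite (bigD1 i) //= ltr_wpDr //.
  by apply: sumr_ge0 => j _; rewrite mulr_ge0 ?exprn_ge0 // ltW.
by rewrite mulr_gt0 // exprn_gt0 // divr_gt0 // normr_gt0.
Qed.

(** * Weights for Q-DSDD tensors *)

Lemma root_itv01 (R : rcfType) (m : nat) (rho : R) : (0 < m)%N -> 0 < rho <= 1 ->
  exists2 y, 0 < y <= 1 & y ^+ m = rho.
Proof.
move=> m0 /andP[rho0 rho1].
have [|y /andP[y0 y1]] := @poly_ivt R ('X^m - rho%:P) 0 1 ler01.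
  by rewrite !hornerE expr1n expr0n -[m == _]negbK -lt0n m0 /= subr_ge0 rho1 sub0r oppr_le0 ltW.
rewrite /root !hornerE subr_eq0 => /eqP yE; exists y => //.
rewrite y1 andbT lt_neqAle y0 andbT eq_sym.
by apply: contraTneq rho0 => y0E; rewrite -yE y0E expr0n -[m == _]negbK -lt0n m0 ltxx.
Qed.

(* At most one row [i] fails to be strictly dominant. Shrinking the weight of a
   single other index [j] to [y] repairs it as soon as [y ^+ m] lies below
   [(a_ii - r_i^j) / |a_ij..j|], and row [j] survives as long as [y ^+ m] exceeds
   [r_j / a_jj]; the hypothesis says that this window is nonempty. *)
Lemma QDSDD_weights (R : realType) (m n : nat) (A : tensor R m.+1 n) :
  (0 < m)%N -> (2 <= n)%N -> QDSDD A -> (forall i, 0 < repentry A i i) ->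
  exists2 y : 'I_n -> R, forall i, 0 < y i &
    forall i, \sum_(t : m.-tuple 'I_n | offdiag (i :: t))
               `|entry A i t| * \prod_(j <- t) y j
             < repentry A i i * y i ^+ m.
Proof.
move=> m0 n2 qA a0.
have row_le (y : 'I_n -> R) (P : pred (m.-tuple 'I_n)) i :
    (forall k, 0 < y k <= 1) ->
    \sum_(t : m.-tuple 'I_n | P t) `|entry A i t| * \prod_(j <- t) y j
      <= \sum_(t : m.-tuple 'I_n | P t) `|entry A i t|.
  move=> y01; apply: ler_sum => t _; rewrite ler_piMr // prodr_ile1 // => k _.
  by have /andP[/ltW -> ->] := y01 k.
have [/forallP dom | ] := boolP [forall i, offsum A i < repentry A i i].
  exists (fun=> 1) => [i|i]; first exact: ltr01.
  rewrite expr1n mulr1; apply: le_lt_trans (dom i).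
  by apply: row_le => k; rewrite ltr01 lexx.
rewrite negb_forall => /existsP[i]; rewrite -leNgt => bad.
(* Since [offsum A i >= repentry A i i], the factor [repentry A i i] cancels from the Q-DSDD
   inequality for [i] and [k]. *)
have good k : k != i -> offsum A k < repentry A k k.
  move=> /(qA i); rewrite (gtr0_norm (a0 _)) (gtr0_norm (a0 _)) /offsum_excl => dom.
  have := le_lt_trans (ler_wpM2r (normr_ge0 (repentry A k i)) bad) dom.
  by rewrite ltr_pM2l // => ?; lra.
have [j ji] : exists j, j != i.
  have [E|?] := eqVneq (Ordinal n2) i; last by exists (Ordinal n2).
  by exists (Ordinal (ltnW n2)); rewrite -E.
have ij : i != j by rewrite eq_sym.
have := qA j i ij; rewrite (gtr0_norm (a0 _)) (gtr0_norm (a0 _)) /offsum_excl => dom.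
set c := `|repentry A i j| in dom.
have aj := a0 j; have ai := a0 i.
(* With [c = 0], [dom] would make [repentry A i i - offsum A i] positive, against [bad]. *)
have c0 : 0 < c.
  rewrite lt_neqAle normr_ge0 andbT eq_sym; apply: contraTneq dom => ->.
  by rewrite -leNgt mulr0 subr0 pmulr_rle0 // subr_le0.
have window : offsum A j / repentry A j j < (repentry A i i - offsum A i + c) / c.
  rewrite ltr_pdivlMr // mulrAC ltr_pdivrMr // [ltRHS]mulrC.
  by apply: lt_le_trans dom _; apply: ler_wpM2l; [exact: ltW | lra].
have low0 : 0 <= offsum A j / repentry A j j.
  by rewrite divr_ge0 ?sumr_ge0 // ltW.
(* Again by [bad]. Hence [rho] and its root [y] are at most 1, so the weights never increase an
   off-diagonal sum. *)
have up1 : (repentry A i i - offsum A i + c) / c <= 1.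
  by rewrite ler_pdivrMr // mul1r; lra.
have [lo up] := midf_lt window; set rho := (_ / 2%:R) in lo up.
have [|y y01 yE] := @root_itv01 _ _ rho m0.
  by apply/andP; split; lra.
pose Y k := if k == j then y else 1.
have Y01 k : 0 < Y k <= 1 by rewrite /Y; case: ifP => // _; rewrite ltr01 lexx.
have Yneq k : k != j -> Y k ^+ m = 1 by rewrite /Y => /negPf ->; rewrite expr1n.
exists Y => [k|k]; first by have /andP[] := Y01 k.
have [->|kj] := eqVneq k j.
  apply: le_lt_trans (row_le _ _ _ Y01) _.
  by rewrite /Y eqxx yE mulrC -ltr_pdivrMr.
rewrite Yneq // mulr1; have [->|ki] := eqVneq k i; last first.
  exact: le_lt_trans (row_le _ _ _ Y01) (good k ki).
have offij : offdiag (i :: [tuple of nseq m j]) by apply: offdiag_cons_nseq.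
(* Only the entry a_{i j ... j} needs its full factor [y ^+ m]; the other terms are bounded with
   weight 1. *)
have rE : offsum A i = c + \sum_(t : m.-tuple 'I_n | offdiag (i :: t)
    && (t != [tuple of nseq m j])) `|entry A i t|.
  by rewrite /offsum (bigD1 [tuple of nseq m j]).
rewrite (bigD1 [tuple of nseq m j]) //= -/(repentry A i j) -/c big_nseq -Monoid.iteropE.
rewrite -[iterop _ _ _ _]/(Y j ^+ m) {1}/Y eqxx yE.
apply: le_lt_trans (lerD (lexx _) (row_le _ _ _ Y01)) _.
by move: up; rewrite ltr_pdivlMr // => up; rewrite mulrC; lra.
Qed.

Lemma QDSDD_positive_definite (R : realType) (m n : nat) (A : tensor R m.+1 n) :
  (0 < m)%N -> (2 <= n)%N -> ~~ odd m.+1 -> symmetric_tensor A -> QDSDD A ->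
  (forall i, 0 < repentry A i i) -> positive_definite A.
Proof.
move=> m0 n2 even symA qA a0; have [y y0 dom] := QDSDD_weights m0 n2 qA a0.
exact: positive_definite_of_weights y0 dom.
Qed.

(** * Subtracting an all-one block *)

Lemma beta_ge0 (R : realType) (m n : nat) (A : tensor R m.+1 n) i : 0 <= beta A i.
Proof. exact: bigmax_ge_id. Qed.

Lemma entry_le_beta (R : realType) (m n : nat) (A : tensor R m.+1 n) (i : 'I_n)
    (t : m.-tuple 'I_n) : offdiag (i :: t) -> entry A i t <= beta A i.
Proof. by move=> ot; apply: le_bigmax_cond. Qed.

Lemma beta_le (R : realType) (m n : nat) (A : tensor R m.+1 n) (i : 'I_n) (c : R) :
  0 <= c -> (forall t : m.-tuple 'I_n, offdiag (i :: t) -> entry A i t <= c) ->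
  beta A i <= c.
Proof. exact: bigmax_le. Qed.

(** As a sum over fewer indices, [Delta_excl] can be compared between two tensors term by term. *)
Lemma Delta_split (R : realType) (m n : nat) (A : tensor R m.+1 n) (i j : 'I_n) :
  (0 < m)%N -> j != i ->
  Delta_excl A j i = \sum_(t : m.-tuple 'I_n | offdiag (j :: t)
    && (t != [tuple of nseq m i])) (beta A j - entry A j t).
Proof.
move=> m0 ji; have oji : offdiag (j :: [tuple of nseq m i]) by apply: offdiag_cons_nseq.
by rewrite /Delta_excl /Delta (bigD1 [tuple of nseq m i]) //= addrC addrK.
Qed.

(** When [beta] vanishes, off-diagonal entries are non-positive, so [Delta] is [offsum] and the two
    families of inequalities coincide. *)
Lemma QDSDD_Z_of_beta0 (R : realType) (m n : nat) (B : tensor R m.+1 n) :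
  (0 < m)%N -> quasi_double_B B -> (forall i, beta B i = 0) -> QDSDD B /\ Z_tensor B.
Proof.
move=> m0 [posB domB] b0.
have neg i (t : m.-tuple 'I_n) : offdiag (i :: t) -> entry B i t <= 0.
  by move=> ot; rewrite -(b0 i); apply: entry_le_beta.
have diag0 i : 0 < repentry B i i by rewrite -(b0 i).
have DE i : Delta B i = offsum B i.
  by apply: eq_bigr => t /neg et; rewrite b0 sub0r ler0_norm.
split=> [i j ji | t ot]; last by case/tupleP: t ot => i t; apply: neg.
have rep0 : repentry B j i <= 0 by apply/neg/offdiag_cons_nseq.
have := domB i j; rewrite eq_sym ji => /(_ isT).
rewrite /Delta_excl /offsum_excl !DE !b0 !subr0 !sub0r mulrC.
by rewrite !(gtr0_norm (diag0 _)) (ler0_norm rep0).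
Qed.

Lemma entry_gt0_beta (R : realType) (m n : nat) (B : tensor R m.+1 n) (i j : 'I_n)
    (t : m.-tuple 'I_n) :
  symmetric_tensor B -> offdiag (i :: t) -> 0 < entry B i t -> j \in i :: t ->
  0 < beta B j.
Proof.
move=> symB ot e0 jt; have [u pu eu] := symmetric_entry_pull symB jt.
rewrite (lt_le_trans e0) // eu entry_le_beta //.
by rewrite -(perm_offdiag pu).
Qed.

Lemma quasi_double_B_step (R : realType) (m n : nat) (B : tensor R m.+1 n) :
  (0 < m)%N -> symmetric_tensor B -> quasi_double_B B ->
  let J := [set i | 0 < beta B i] in J != set0 ->
  exists (B' : tensor R m.+1 n) (h : R),
    [/\ 0 < h, B = B' + h *: partially_all_one R m.+1 J,
        symmetric_tensor B', quasi_double_B B' &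
        [set i | 0 < beta B' i] \proper J].
Proof.
move=> m0 symB [posB domB] J /set0Pn [i0 i0J].
have inJ i : (i \in J) = (0 < beta B i) by rewrite inE.
case: (@arg_minP _ _ _ i0 (mem J) (beta B) i0J) => p pJ pmin.
have [h hE] : exists h, h = beta B p by exists (beta B p).
have h0 : 0 < h by rewrite hE -inJ.
pose B' := B - h *: partially_all_one R m.+1 J.
have entryE i (t : m.-tuple 'I_n) :
    entry B' i t = entry B i t - h * ((i \in J) && all (mem J) t)%:R.
  by rewrite /entry !ffunE.
have outJ i (t : m.-tuple 'I_n) : offdiag (i :: t) ->
    ~~ ((i \in J) && all (mem J) t) -> entry B i t <= 0.
  move=> ot; apply: contraNT; rewrite -ltNge => e0.
  suff: all (mem J) (i :: t) by [].
  by apply/allP => j jt /=; rewrite inJ (entry_gt0_beta symB ot e0 jt).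
(* For [i] in [J], minimality of [h] gives [beta B i - h >= 0], which bounds both the default 0 of
   the maximum and the non-positive entries outside the block. *)
have betaE i : beta B' i = beta B i - h * (i \in J)%:R.
  apply/eqP; rewrite eq_le lerBlDr; apply/andP; split.
    apply: beta_le => [|t ot].
      case: (boolP (i \in J)) => [/pmin|_]; rewrite ?mulr1 ?mulr0 ?subr0.
        by rewrite subr_ge0 hE.
      by rewrite beta_ge0.
    rewrite entryE; case: (boolP (_ && all _ _)) => [/andP[-> _]|/(outJ _ _ ot)].
      by rewrite lerD2r entry_le_beta.
    rewrite mulr0 subr0 => /le_trans; apply.
    case: (boolP (i \in J)) => [/pmin|_]; rewrite ?mulr1 ?mulr0 ?subr0.
      by rewrite subr_ge0 hE.
    by rewrite beta_ge0.
  apply: beta_le => [|t ot].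
    by rewrite addr_ge0 ?beta_ge0 // mulr_ge0 ?ler0n // ltW.
  have := entry_le_beta B' ot; rewrite entryE.
  case: (i \in J); last by rewrite !mulr0 subr0 addr0.
  case: (all _ _); rewrite !(mulr1, mulr0, subr0); first by rewrite lerBlDr.
  by move=> /le_trans -> //; rewrite lerDl ltW.
(* For [i] in [J] the diagonal entry lies in the block, so it and [beta] both drop by [h]. *)
have diagE i : repentry B' i i - beta B' i = repentry B i i - beta B i.
  rewrite /repentry entryE betaE /= all_nseq andb_orr andbb.
  by case: (i \in J); rewrite ?andbF ?orbT ?mulr0 ?mulr1; lra.
have gap_le i (t : m.-tuple 'I_n) :
    beta B' i - entry B' i t <= beta B i - entry B i t.
  rewrite entryE betaE; case: (i \in J); last by rewrite !mulr0 !subr0.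
  by case: (all _ _); rewrite !(mulr1, mulr0, subr0); lra.
have gap_ge0 i (t : m.-tuple 'I_n) : offdiag (i :: t) -> 0 <= beta B' i - entry B' i t.
  by move=> ot; rewrite subr_ge0 entry_le_beta.
have BE : B = B' + h *: partially_all_one R m.+1 J by rewrite subrK.
exists B', h; split=> //.
- apply/symmetric_tensorP => s t st; rewrite !ffunE (perm_all _ st).
  by move/symmetric_tensorP: symB => /(_ _ _ st) ->.
- split=> [i|i j ij]; first by rewrite -subr_gt0 diagE subr_gt0.
  have ji : j != i by rewrite eq_sym.
  have oji : offdiag (j :: [tuple of nseq m i]) by apply: offdiag_cons_nseq.
  have Dle : Delta B' i <= Delta B i by apply: ler_sum.
  have D0 : 0 <= Delta B' i by apply: sumr_ge0 => t; apply: gap_ge0.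
  have Dxle : Delta_excl B' j i <= Delta_excl B j i.
    by rewrite !Delta_split //; apply: ler_sum.
  (* Smaller non-negative gaps lower the right-hand side of the condition, and a smaller
     [Delta_excl] raises the left-hand side. *)
  apply: (@le_lt_trans _ _ ((beta B j - repentry B j i) * Delta B i)).
    by apply: ler_pM => //; [apply: gap_ge0 | apply: gap_le].
  apply: lt_le_trans (domB i j ij) _; rewrite !diagE ler_pM2l ?subr_gt0 //.
  by rewrite lerD2l lerN2.
(* The minimizing row [p] reaches [beta] equal to 0 and leaves the set. *)
- apply/properP; split; last first.
    by exists p => //; rewrite inE betaE [p \in J]pJ mulr1 hE subrr ltxx.
  apply/subsetP => i; rewrite !inE betaE => /lt_le_trans; apply.
  by rewrite gerBl mulr_ge0 ?ler0n // ltW.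
Qed.

(** * Decomposition and conclusion *)

(** Induction on the number of rows with positive [beta]. The positive diagonal of [M] is recorded
    because [QDSDD] sees only absolute values. *)
Lemma quasi_double_B_decomposition (R : realType) (m n : nat) (B : tensor R m.+1 n) :
  (0 < m)%N -> symmetric_tensor B -> quasi_double_B B ->
  exists (M : tensor R m.+1 n) (L : seq (R * {set 'I_n})),
    [/\ [/\ QDSDD M, symmetric_tensor M & Z_tensor M],
        forall i, 0 < repentry M i i,
        {in L, forall p, 0 < p.1 /\ p.2 != set0} &
        B = M + \sum_(p <- L) p.1 *: partially_all_one R m.+1 p.2].
Proof.
move=> m0; have [k] := ubnP #|[set i | 0 < beta B i]|.
elim: k B => // k IH B; rewrite ltnS => leJ symB qB.
have [J0|JN0] := eqVneq [set i | 0 < beta B i] set0.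
  have b0 i : beta B i = 0.
    apply/eqP; rewrite eq_le beta_ge0 andbT leNgt.
    by apply/negP => bi; have := in_set0 i; rewrite -J0 inE bi.
  have [qdB zB] := QDSDD_Z_of_beta0 m0 qB b0.
  exists B, [::]; split=> //; last by rewrite big_nil addr0.
  by move=> i; rewrite -(b0 i); apply: qB.1.
have [B' [h [h0 BE symB' qB' ltJ]]] := quasi_double_B_step m0 symB qB JN0.
have [|M [L [MP M0 LP B'E]]] := IH B' _ symB' qB'.
  exact: leq_trans (proper_card ltJ) leJ.
exists M, ((h, [set i | 0 < beta B i]) :: L); split=> //.
  by move=> p; rewrite inE => /predU1P [-> | /LP].
by rewrite big_cons /= addrCA -B'E addrC.
Qed.

Theorem theorem5 (R : realType) (m n : nat)
  (hm : (2 <= m.+1)%N) (hn : (2 <= n)%N)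
  (B : tensor R m.+1 n)
  (Bsym : symmetric_tensor B) (BqdB : quasi_double_B B) :
  ([/\ QDSDD B, symmetric_tensor B & Z_tensor B] \/
   (exists (M : tensor R m.+1 n) (s : nat)
           (h : 'I_s -> R) (J : 'I_s -> {set 'I_n}),
      [/\ QDSDD M, symmetric_tensor M & Z_tensor M] /\
      (0 < s)%N /\
      (forall k : 'I_s, 0 < h k /\ J k != set0) /\
      B = M + \sum_(k < s) h k *: partially_all_one R m.+1 (J k))) /\
  (~~ odd m.+1 -> positive_definite B /\ P_tensor B).
Proof.
have [M [L [MP M0 LP BE]]] := quasi_double_B_decomposition hm Bsym BqdB.
split.
  (* An empty list means [B = M], the first alternative; otherwise the length of the list is the
     positive [s]. *)
  case: L => [|q L] in LP BE *.
    by left; rewrite BE big_nil addr0.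
  right; pose l := tnth (in_tuple (q :: L)).
  exists M, (size (q :: L)), (fun k => (l k).1), (fun k => (l k).2).
  do !split=> //; last by rewrite {1}BE big_tnth.
    by have [] := LP (l k) (mem_tnth _ _).
  by have [] := LP (l k) (mem_tnth _ _).
move=> even; suff pdB : positive_definite B.
  by split=> //; apply: positive_definite_P_tensor.
case: MP => qM symM _ x x0; rewrite BE tformD.
have posM := QDSDD_positive_definite hm hn even symM qM M0 x0.
rewrite tform_sum ltr_wpDr // big_seq; apply: sumr_ge0 => p /LP [p0 _].
by rewrite tformZ tform_partially_all_one mulr_ge0 ?exprn_even_ge0 // ltW.
Qed.
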